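(* Let $X$ be a path-connected and locally path-connected topological space with base point $x_0\in X$. Suppose that $H\leq \pi_1(X,x_0)$ is locally quasinormal and that for every $x,y\in X$ and for every path $\beta:[0,1]\rightarrow X$ from $\beta(0)=x$ to $\beta(1)=y$, the standard monodromy $\phi_\beta:p_H^{-1}(x)\rightarrow p_H^{-1}(y)$ is continuous. Then $p_H:\widetilde{X}_H\rightarrow X$ is a fibration.
   Context: Paths are continuous maps from $[0,1]$; $\alpha\cdot\gamma$ denotes concatenation of paths, $\beta^-(t)=\beta(1-t)$ the reverse path, and $[\,\cdot\,]$ the homotopy class relative to endpoints. Construction of $p_H:\widetilde{X}_H\to X$: On the set of all paths $\alpha:([0,1],0)\rightarrow (X,x_0)$ (paths starting at $x_0$), let $\alpha\sim\beta$ if and only if $\alpha(1)=\beta(1)$ and $[\alpha\cdot\beta^-]\in H$. The equivalence class of $\alpha$ is denoted $\langle\alpha\rangle$, and $\widetilde{X}_H$ is the set of all equivalence classes. It carries the topology generated by the basis elements $\langle\alpha,U\rangle=\{\langle\alpha\cdot\gamma\rangle\mid \gamma:([0,1],0)\rightarrow (U,\alpha(1))\text{ a path}\}$, where $U\subseteq X$ is open and $\langle\alpha\rangle\in\widetilde{X}_H$ with $\alpha(1)\in U$. The map $p_H:\widetilde{X}_H\rightarrow X$ is the (continuous) endpoint projection $p_H(\langle\alpha\rangle)=\alpha(1)$. Fibers $p_H^{-1}(x)$ carry the subspace topology. Standard monodromy: for a path $\beta:[0,1]\to X$ from $x$ to $y$, $\phi_\beta:p_H^{-1}(x)\rightarrow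 p_H^{-1}(y)$ is the bijection $\phi_\beta(\langle\alpha\rangle)=\langle\alpha\cdot\beta\rangle$ (not necessarily continuous). For a path $\alpha:([0,1],0)\rightarrow (X,x_0)$ and an open neighborhood $U$ of $\alpha(1)$ in $X$, let $\pi(\alpha,U)=\{[\alpha\cdot \delta\cdot \alpha^-]\mid \delta:([0,1],\{0,1\})\rightarrow (U,\alpha(1))\}\leq \pi_1(X,x_0)$, with $\delta$ ranging over loops in $U$ based at $\alpha(1)$. A subgroup $H\leq\pi_1(X,x_0)$ is locally quasinormal if for every $x\in X$, every path $\alpha:[0,1]\to X$ from $\alpha(0)=x_0$ to $\alpha(1)=x$, and every open neighborhood $U$ of $x$ in $X$, there is an open neighborhood $V$ of $x$ in $X$ with $x\in V\subseteq U$ such that $H\pi(\alpha,V)=\pi(\alpha,V)H$ (equality of product sets). Fibration means Hurewicz fibration: for every topological space $Y$ and all continuous maps $\widetilde{f}:Y\to\widetilde{X}_H$ and $F:Y\times[0,1]\to X$ with $p_H\circ\widetilde{f}(y)=F(y,0)$ for all $y\in Y$, there is a continuous map $\widetilde{F}:Y\times[0,1]\to\widetilde{X}_H$ with $p_H\circ\widetilde{F}=F$ and $\widetilde{F}(y,0)=\widetilde{f}(y)$ for all $y\in Y$. *)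

(* Defs.v *)
From HB Require Import structures.
From mathcomp Require Import all_boot all_order all_algebra generic_quotient.
From mathcomp Require Import all_classical reals topology normedtype.
From mathcomp Require Import homotopy.
From mathcomp Require Import lra.

Set Implicit Arguments.
Unset Strict Implicit.
Unset Printing Implicit Defensive.

Import Order.TTheory GRing.Theory Num.Theory.
Import numFieldTopology.Exports numFieldNormedType.Exports.

Local Open Scope classical_set_scope.
Local Open Scope ring_scope.

Definition unit_interval (R : realType) : Type := set_type `[0 : R, 1]%classic.

HB.instance Definition _ (R : realType) :=
  Topological.copy (unit_interval R) (set_type `[0 : R, 1]%classic).

Section unit_interval.
Context {R : realType}.
Local Notation I := (unit_interval R).

Definition ival (t : I) : R := set_val t.

Lemma clamp_subproof (r : R) :
  Order.max 0 (Order.min r 1) \in (`[0, 1]%classic : set R).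
Proof. by rewrite inE /= in_itv /= le_max lexx /= ge_max ler01 ge_min lexx orbT. Qed.

(* The retraction of the line onto the unit interval. It lets parameters such as
   2 t - 1 be fed to a path without carrying a membership proof. *)
Definition clamp (r : R) : I :=
  exist (fun r => r \in (`[0, 1]%classic : set R)) _ (clamp_subproof r).

Lemma ival_clamp r : ival (clamp r) = Order.max 0 (Order.min r 1).
Proof. by []. Qed.

Lemma ival_ge0 (t : I) : 0 <= ival t.
Proof. by have := set_valP t; rewrite /= in_itv /= => /andP[]. Qed.

Lemma ival_le1 (t : I) : ival t <= 1.
Proof. by have := set_valP t; rewrite /= in_itv /= => /andP[]. Qed.

Lemma ival_inj : injective ival.
Proof. by move=> s t; exact: val_inj. Qed.

Lemma clampK r : 0 <= r <= 1 -> ival (clamp r) = r.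
Proof. by move=> /andP[r0 r1]; rewrite ival_clamp min_l// max_r. Qed.

Lemma ivalK : cancel ival clamp.
Proof. by move=> t; apply: ival_inj; rewrite clampK// ival_ge0 ival_le1. Qed.

Lemma unit_interval_neq : clamp 0 != clamp 1.
Proof.
apply/eqP => /(congr1 ival); rewrite !clampK ?lexx ?ler01//.
by move/eqP; rewrite eq_sym oner_eq0.
Qed.

End unit_interval.

HB.instance Definition _ (R : realType) :=
  @isBiPointed.Build (unit_interval R) (clamp 0) (clamp 1) unit_interval_neq.

Section unit_interval_theory.
Context {R : realType}.
Local Notation I := (unit_interval R).

Lemma ival_zero : ival (zero : I) = 0.
Proof. by rewrite clampK// lexx ler01. Qed.

Lemma ival_one : ival (one : I) = 1.
Proof. by rewrite clampK// lexx ler01. Qed.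

Lemma clamp_le0 (r : R) : r <= 0 -> clamp r = zero.
Proof.
move=> r0; apply: ival_inj; rewrite ival_zero ival_clamp.
by rewrite min_l ?max_l// (le_trans r0).
Qed.

Lemma clamp_ge1 (r : R) : 1 <= r -> clamp r = one.
Proof.
by move=> r1; apply: ival_inj; rewrite ival_one ival_clamp min_r// max_r.
Qed.

Lemma ival_continuous : continuous (@ival R).
Proof. exact: initial_continuous. Qed.

Lemma clamp_continuous : continuous (@clamp R).
Proof.
apply: continuous_comp_initial => r.
rewrite (_ : _ \o _ = (fun r : R => Num.max 0 (Num.min r 1)))//.
apply: (@continuous_max R R (cst 0) (fun r => Num.min r 1)).
  exact: cst_continuous.
by apply: (@continuous_min R R id (cst 1)) => //; exact: cst_continuous.
Qed.

Lemma clampP (r : R) : [\/ r < 0 /\ clamp r = zero,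
  1 < r /\ clamp r = one | 0 <= r <= 1 /\ ival (clamp r) = r].
Proof.
have [r0|r0] := ltP r 0; first by constructor 1; rewrite clamp_le0 ?ltW.
have [r1|r1] := ltP 1 r; first by constructor 2; rewrite clamp_ge1 ?ltW.
by constructor 3; rewrite clampK ?r0.
Qed.

Lemma comp_continuous (A B C : topologicalType) (f : A -> B) (g : B -> C) :
  continuous f -> continuous g -> continuous (fun a => g (f a)).
Proof. by move=> cf cg a; exact: (continuous_comp (cf a) (cg (f a))). Qed.

Lemma pair_continuous (A B C : topologicalType) (f : A -> B) (g : A -> C) :
  continuous f -> continuous g -> continuous (fun a => (f a, g a)).
Proof. by move=> cf cg a; apply: cvg_pair; [exact: cf|exact: cg]. Qed.

Lemma fst_continuous (A B : topologicalType) : continuous (@fst A B).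
Proof. by move=> a; exact: cvg_fst. Qed.

Lemma snd_continuous (A B : topologicalType) : continuous (@snd A B).
Proof. by move=> a; exact: cvg_snd. Qed.

Lemma clamp_comp_continuous (W : topologicalType) (f : W -> R) :
  continuous f -> continuous (fun w => clamp (f w)).
Proof. by move=> cf; apply: (comp_continuous cf); exact: clamp_continuous. Qed.

Lemma continuous_glue (W T : topologicalType) (u : W -> R) (c : R)
    (f g : W -> T) : continuous u -> continuous f -> continuous g ->
  (forall w, u w = c -> f w = g w) ->
  continuous (fun w => if u w <= c then f w else g w).
Proof.
move=> cu cf cg fg.
have cA : closed [set w | u w <= c].
  exact: (closed_comp (fun w _ => cu w) (@closed_le R c)).
have cB : closed [set w | c <= u w].
  exact: (closed_comp (fun w _ => cu w) (@closed_ge R c)).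
apply/continuous_subspace_setT.
have -> : [set: W] = [set w | u w <= c] `|` [set w | c <= u w].
  by apply/seteqP; split => // w _ /=; apply/orP; exact: le_total.
apply: withinU_continuous => //.
- apply: (@subspace_eq_continuous _ _ _ f); last exact: continuous_subspaceT.
  by move=> w /set_mem /= wc; rewrite /from_subspace wc.
- apply: (@subspace_eq_continuous _ _ _ g); last exact: continuous_subspaceT.
  move=> w /set_mem /= cw; rewrite /from_subspace; case: ifPn => // wc; rewrite fg//.
  by apply/eqP; rewrite eq_le wc.
Qed.

End unit_interval_theory.

Section path_operations.
Context {R : realType} {T : topologicalType}.
Local Notation I := (unit_interval R).

Section concat.
Variables (x y z : T) (p : {path I from x to y}) (q : {path I from y to z}).

Definition concat_fun (t : I) : T :=
  if ival t <= 2^-1 then p (clamp (2 * ival t))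
  else q (clamp (2 * ival t - 1)).

Lemma concat_continuous : continuous concat_fun.
Proof.
have c2 : continuous (fun t : I => 2 * ival t).
  move=> t; apply: (@continuousM R I (cst 2) (@ival R)).
    exact: cst_continuous.
  exact: ival_continuous.
apply: (@continuous_glue R) => [|||t ->].
- exact: ival_continuous.
- apply: (comp_continuous (clamp_comp_continuous c2)).
  exact: cts_fun.
- apply: (comp_continuous (f := fun t => clamp (2 * ival t - 1))).
    apply: clamp_comp_continuous => t.
    apply: (@continuousB R R^o I (fun t => 2 * ival t) (cst 1)); first exact: c2.
    exact: cst_continuous.
  exact: cts_fun.
- by rewrite clamp_ge1 ?clamp_le0 ?path_zero ?path_one//; lra.
Qed.

Lemma concat_zero : concat_fun zero = x.
Proof. by rewrite /concat_fun ival_zero ifT ?clamp_le0 ?path_zero//; lra. Qed.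

Lemma concat_one : concat_fun one = z.
Proof.
by rewrite /concat_fun ival_one ifF ?clamp_ge1 ?path_one//; [lra|apply/negP; lra].
Qed.

Definition concat : {path I from x to z} :=
  mk_path concat_continuous concat_zero concat_one.

End concat.

Section reverse.
Variables (x y : T) (p : {path I from x to y}).

Definition reverse_fun (t : I) : T := p (clamp (1 - ival t)).

Lemma reverse_continuous : continuous reverse_fun.
Proof.
apply: (comp_continuous (f := fun t => clamp (1 - ival t))).
  apply: clamp_comp_continuous => t.
  apply: (@continuousB R R^o I (cst 1) (@ival R)); first exact: cst_continuous.
  exact: ival_continuous.
exact: cts_fun.
Qed.

Lemma reverse_zero : reverse_fun zero = y.
Proof. by rewrite /reverse_fun ival_zero clamp_ge1 ?path_one//; lra. Qed.

Lemma reverse_one : reverse_fun one = x.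
Proof. by rewrite /reverse_fun ival_one clamp_le0 ?path_zero//; lra. Qed.

Definition reverse : {path I from y to x} :=
  mk_path reverse_continuous reverse_zero reverse_one.

End reverse.

Definition const_path (x : T) : {path I from x to x} := cst x.

Definition path_cast (x y y' : T) (e : y = y') (p : {path I from x to y}) :
    {path I from x to y'} :=
  ecast y0 {path I from x to y0} e p.

Definition path_homotopic (x y : T) (p q : {path I from x to y}) : Prop :=
  exists h : I * I -> T, [/\ continuous h,
    forall t, h (t, zero) = p t, forall t, h (t, one) = q t,
    forall s, h (zero, s) = x & forall s, h (one, s) = y].

End path_operations.

Section homotopy_lemmas.
Context {R : realType} {T : topologicalType}.
Local Notation I := (unit_interval R).

Lemma homotopic_refl (x y : T) (p q : {path I from x to y}) :
  p =1 q -> path_homotopic p q.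
Proof.
move=> pq; exists (fun ts => p ts.1); split => //=.
- apply: (comp_continuous (f := fst)); last exact: cts_fun.
  exact: fst_continuous.
- by move=> s; rewrite path_zero.
- by move=> s; rewrite path_one.
Qed.

Lemma homotopic_sym (x y : T) (p q : {path I from x to y}) :
  path_homotopic p q -> path_homotopic q p.
Proof.
move=> [h [ch h0 h1 hx hy]].
exists (fun ts => h (ts.1, clamp (1 - ival ts.2))); split => //=.
- apply: (comp_continuous (f := fun ts : I * I => (ts.1, clamp (1 - ival ts.2)))) => //.
  apply: pair_continuous; first exact: fst_continuous.
  apply: (clamp_comp_continuous (f := fun ts : I * I => 1 - ival ts.2)) => ts.
  apply: (@continuousB R R^o _ (cst 1) (fun ts : I * I => ival ts.2)).
    exact: cst_continuous.
  apply: (comp_continuous (f := snd)); last exact: ival_continuous.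
  exact: snd_continuous.
- by move=> t; rewrite ival_zero clamp_ge1 ?h1//; lra.
- by move=> t; rewrite ival_one clamp_le0 ?h0//; lra.
Qed.

Lemma homotopic_trans (x y : T) (p q r : {path I from x to y}) :
  path_homotopic p q -> path_homotopic q r -> path_homotopic p r.
Proof.
move=> [h [ch h0 h1 hx hy]] [k [ck k0 k1 kx ky]].
have c2 : continuous (fun ts : I * I => ival ts.2).
  apply: (comp_continuous (f := snd)); last exact: ival_continuous.
  exact: snd_continuous.
have c3 : continuous (fun ts : I * I => 2 * ival ts.2).
  move=> ts; apply: (@continuousM R _ (cst 2) (fun ts : I * I => ival ts.2)).
    exact: cst_continuous.
  exact: c2.
exists (fun ts => if ival ts.2 <= 2^-1 then h (ts.1, clamp (2 * ival ts.2))
  else k (ts.1, clamp (2 * ival ts.2 - 1))); split => //=.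
- apply: (continuous_glue (u := fun ts : I * I => ival ts.2)) => //.
  + apply: (comp_continuous (f := fun ts : I * I => (ts.1, clamp (2 * ival ts.2)))) => //.
    apply: pair_continuous; first exact: fst_continuous.
    exact: (clamp_comp_continuous (f := fun ts : I * I => 2 * ival ts.2)).
  + apply: (comp_continuous (f := fun ts : I * I => (ts.1, clamp (2 * ival ts.2 - 1)))) => //.
    apply: pair_continuous; first exact: fst_continuous.
    apply: (clamp_comp_continuous (f := fun ts : I * I => 2 * ival ts.2 - 1)) => ts.
    apply: (@continuousB R R^o _ (fun ts : I * I => 2 * ival ts.2) (cst 1)); first exact: c3.
    exact: cst_continuous.
  + move=> [t s] /= ->.
    by rewrite clamp_ge1 ?clamp_le0 ?h1 ?k0//; lra.
- by move=> t; rewrite ival_zero ifT ?clamp_le0 ?h0//; lra.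
- by move=> t; rewrite ival_one ifF ?clamp_ge1 ?k1//; [lra|apply/negP; lra].
- by move=> s; rewrite hx kx if_same.
- by move=> s; rewrite hy ky if_same.
Qed.

(* Two reparametrisations of the same function are homotopic along the
   straight line joining the parameters. *)
Lemma homotopic_reparam (x y : T) (p q : {path I from x to y}) (r : I -> T)
    (phi psi : I -> R) : continuous r -> continuous phi -> continuous psi ->
  phi zero = psi zero -> phi one = psi one ->
  (forall t, p t = r (clamp (phi t))) -> (forall t, q t = r (clamp (psi t))) ->
  path_homotopic p q.
Proof.
move=> cr cphi cpsi e0 e1 pE qE.
pose f (ts : I * I) : R := phi ts.1 + ival ts.2 * (psi ts.1 - phi ts.1).
have c1 := @fst_continuous I I.
have c2 : continuous (fun ts : I * I => ival ts.2).
  apply: (comp_continuous (f := snd)); last exact: ival_continuous.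
  exact: snd_continuous.
exists (fun ts => r (clamp (f ts))); split => [|t|t|s|s].
- apply: (comp_continuous (f := fun ts => clamp (f ts))) => //.
  apply: clamp_comp_continuous => ts; rewrite /f.
  apply: (@continuousD R R^o _ (fun ts : I * I => phi ts.1)
    (fun ts : I * I => ival ts.2 * (psi ts.1 - phi ts.1))).
    exact: (comp_continuous c1 cphi).
  apply: (@continuousM R _ (fun ts : I * I => ival ts.2)
    (fun ts : I * I => psi ts.1 - phi ts.1)); first exact: c2.
  apply: (@continuousB R R^o _ (fun ts : I * I => psi ts.1)
    (fun ts : I * I => phi ts.1)).
    exact: (comp_continuous c1 cpsi).
  exact: (comp_continuous c1 cphi).
- by rewrite pE /f /= ival_zero mul0r addr0.
- by rewrite qE /f /= ival_one mul1r addrC subrK.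
- by rewrite /f /= e0 subrr mulr0 addr0 -qE path_zero.
- by rewrite /f /= e1 subrr mulr0 addr0 -qE path_one.
Qed.

Lemma homotopic_concat (x y z : T) (p p' : {path I from x to y})
    (q q' : {path I from y to z}) :
  path_homotopic p p' -> path_homotopic q q' ->
  path_homotopic (concat p q) (concat p' q').
Proof.
move=> [h [ch h0 h1 hx hy]] [k [ck k0 k1 kx ky]].
have c1 : continuous (fun ts : I * I => ival ts.1).
  apply: (comp_continuous (f := fst)); last exact: ival_continuous.
  exact: fst_continuous.
have c3 : continuous (fun ts : I * I => 2 * ival ts.1).
  move=> ts; apply: (@continuousM R _ (cst 2) (fun ts : I * I => ival ts.1)).
    exact: cst_continuous.
  exact: c1.
exists (fun ts => if ival ts.1 <= 2^-1 then h (clamp (2 * ival ts.1), ts.2)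
  else k (clamp (2 * ival ts.1 - 1), ts.2)); split => /=.
- apply: (continuous_glue (u := fun ts : I * I => ival ts.1)) => //.
  + apply: (comp_continuous (f := fun ts : I * I => (clamp (2 * ival ts.1), ts.2))) => //.
    apply: pair_continuous; last exact: snd_continuous.
    exact: (clamp_comp_continuous (f := fun ts : I * I => 2 * ival ts.1)).
  + apply: (comp_continuous (f := fun ts : I * I => (clamp (2 * ival ts.1 - 1), ts.2))) => //.
    apply: pair_continuous; last exact: snd_continuous.
    apply: (clamp_comp_continuous (f := fun ts : I * I => 2 * ival ts.1 - 1)) => ts.
    apply: (@continuousB R R^o _ (fun ts : I * I => 2 * ival ts.1) (cst 1)); first exact: c3.
    exact: cst_continuous.
  + move=> [t s] /= ->.
    by rewrite clamp_ge1 ?clamp_le0 ?hy ?kx//; lra.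
- by move=> t; rewrite h0 k0.
- by move=> t; rewrite h1 k1.
- by move=> t; rewrite ival_zero ifT ?clamp_le0 ?hx//; lra.
- by move=> t; rewrite ival_one ifF ?clamp_ge1 ?ky//; [lra|apply/negP; lra].
Qed.

Lemma reverseK (x y : T) (p : {path I from x to y}) :
  reverse (reverse p) = p.
Proof.
apply/path_eqP => t; rewrite /= /mk_path /reverse_fun /= /mk_path /reverse_fun.
congr (p _); apply: ival_inj.
have := ival_ge0 t; have := ival_le1 t => t1 t0.
by rewrite !clampK; lra.
Qed.

Lemma homotopic_reverse (x y : T) (p p' : {path I from x to y}) :
  path_homotopic p p' -> path_homotopic (reverse p) (reverse p').
Proof.
move=> [h [ch h0 h1 hx hy]].
exists (fun ts => h (clamp (1 - ival ts.1), ts.2)); split => /=.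
- apply: (comp_continuous (f := fun ts : I * I => (clamp (1 - ival ts.1), ts.2))) => //.
  apply: pair_continuous; last exact: snd_continuous.
  apply: (clamp_comp_continuous (f := fun ts : I * I => 1 - ival ts.1)) => ts.
  apply: (@continuousB R R^o _ (cst 1) (fun ts : I * I => ival ts.1)).
    exact: cst_continuous.
  apply: (comp_continuous (f := fst)); last exact: ival_continuous.
  exact: fst_continuous.
- by move=> t; rewrite h0.
- by move=> t; rewrite h1.
- by move=> s; rewrite ival_zero clamp_ge1 ?hy//; lra.
- by move=> s; rewrite ival_one clamp_le0 ?hx//; lra.
Qed.

Let affine (a b : R) : continuous (fun t : I => a * ival t + b).
Proof.
move=> t; apply: (@continuousD R R^o _ (fun t : I => a * ival t) (cst b)).
  apply: (@continuousM R _ (cst a) (@ival R)); first exact: cst_continuous.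
  exact: ival_continuous.
exact: cst_continuous.
Qed.

Lemma homotopic_1concat (x y : T) (p : {path I from x to y}) :
  path_homotopic (concat (const_path x) p) p.
Proof.
apply: (@homotopic_reparam _ _ _ _ p
  (fun t => Num.max 0 (2 * ival t + (- 1))) (@ival R)).
- exact: cts_fun.
- move=> t; apply: (@continuous_max R I (cst 0) (fun t => 2 * ival t + (- 1))).
    exact: cst_continuous.
  exact: affine.
- exact: ival_continuous.
- by rewrite ival_zero max_l//; lra.
- by rewrite ival_one max_r; lra.
- move=> t; rewrite /= /mk_path /concat_fun; case: leP => t2.
    by rewrite max_l ?(@clamp_le0 R 0) ?path_zero//; lra.
  by rewrite max_r//; lra.
- by move=> t; rewrite ivalK.
Qed.

Lemma homotopic_concat1 (x y : T) (p : {path I from x to y}) :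
  path_homotopic (concat p (const_path y)) p.
Proof.
apply: (@homotopic_reparam _ _ _ _ p
  (fun t => Num.min 1 (2 * ival t + 0)) (@ival R)).
- exact: cts_fun.
- move=> t; apply: (@continuous_min R I (cst 1) (fun t => 2 * ival t + 0)).
    exact: cst_continuous.
  exact: affine.
- exact: ival_continuous.
- by rewrite ival_zero min_r; lra.
- by rewrite ival_one min_l//; lra.
- move=> t; rewrite /= /mk_path /concat_fun addr0; case: leP => t2.
    by rewrite min_r//; lra.
  by rewrite min_l ?(@clamp_ge1 R 1) ?path_one//; lra.
- by move=> t; rewrite ivalK.
Qed.

Lemma homotopic_concatV (x y : T) (p : {path I from x to y}) :
  path_homotopic (concat p (reverse p)) (const_path x).
Proof.
apply: (@homotopic_reparam _ _ _ _ p
  (fun t => Num.min (2 * ival t + 0) (- 2 * ival t + 2)) (cst 0)).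
- exact: cts_fun.
- move=> t; apply: (@continuous_min R I (fun t => 2 * ival t + 0)
    (fun t => - 2 * ival t + 2)); exact: affine.
- exact: cst_continuous.
- by rewrite ival_zero min_l /cst; lra.
- by rewrite ival_one min_r /cst; lra.
- move=> t; rewrite /= /mk_path /concat_fun addr0; case: leP => t2.
    by rewrite min_l//; lra.
  rewrite min_r/=; last by lra.
  rewrite /mk_path /reverse_fun; congr (p (clamp _)).
  by rewrite clampK; have := ival_le1 t; lra.
- by move=> t /=; rewrite clamp_le0 ?path_zero.
Qed.

Lemma homotopic_concatA (w x y z : T) (p : {path I from w to x})
    (q : {path I from x to y}) (r : {path I from y to z}) :
  path_homotopic (concat p (concat q r)) (concat (concat p q) r).
Proof.
apply: (@homotopic_reparam _ _ _ _ (concat (concat p q) r)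
  (fun t => Num.max (Num.max (2^-1 * ival t + 0) (1 * ival t + (- 4^-1)))
    (2 * ival t + (- 1))) (@ival R)).
- exact: cts_fun.
- move=> t; apply: (@continuous_max R I
    (fun t => Num.max (2^-1 * ival t + 0) (1 * ival t + (- 4^-1)))
    (fun t => 2 * ival t + (- 1))); last exact: affine.
  apply: (@continuous_max R I (fun t => 2^-1 * ival t + 0)
    (fun t => 1 * ival t + (- 4^-1))); exact: affine.
- exact: ival_continuous.
- by rewrite ival_zero !max_l; lra.
- by rewrite ival_one max_r ?max_r; lra.
- move=> t; have := ival_ge0 t; have := ival_le1 t => t1 t0.
  have [t2|t2] := leP (ival t) 2^-1.
    rewrite (max_l (x := Num.max _ _)) ?max_l; [|lra..].
    rewrite /= /mk_path /concat_fun t2 clampK; last by lra.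
    rewrite ifT; last by lra.
    rewrite /= /mk_path /concat_fun clampK; last by lra.
    by rewrite ifT; [congr (p (clamp _)); lra|lra].
  have [t3|t3] := leP (ival t) (3 / 4).
    rewrite (max_l (x := Num.max _ _)) ?max_r; [|lra..].
    rewrite /= /mk_path /concat_fun ifF; last by apply/negP; lra.
    rewrite /= /mk_path /concat_fun clampK; last by lra.
    rewrite ifT; last by lra.
    rewrite clampK; last by lra.
    rewrite ifT; last by lra.
    rewrite clampK; last by lra.
    by rewrite ifF; [congr (q (clamp _)); lra|apply/negP; lra].
  rewrite max_r; last by rewrite max_r; lra.
  rewrite /= /mk_path /concat_fun ifF; last by apply/negP; lra.
  rewrite /= /mk_path /concat_fun clampK; last by lra.
  by rewrite !ifF//; apply/negP; lra.
- by move=> t; rewrite ivalK.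
Qed.

End homotopy_lemmas.

Section homotopy_class.
Context {R : realType} {X : topologicalType}.
Local Notation I := (unit_interval R).
Local Open Scope quotient_scope.

Section classes.
Variables x y : X.

Definition homotopic_rel (p q : {path I from x to y}) : bool :=
  `[< path_homotopic p q >].

Lemma homotopic_rel_refl : reflexive homotopic_rel.
Proof. by move=> p; apply/asboolP/homotopic_refl. Qed.

Lemma homotopic_rel_sym : symmetric homotopic_rel.
Proof.
by move=> p q; apply/idP/idP => /asboolP pq; apply/asboolP/homotopic_sym.
Qed.

Lemma homotopic_rel_trans : transitive homotopic_rel.
Proof.
move=> q p r /asboolP pq /asboolP qr; apply/asboolP.
exact: homotopic_trans qr.
Qed.

Canonical homotopic_equiv := EquivRel homotopic_rel
  homotopic_rel_refl homotopic_rel_sym homotopic_rel_trans.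

Definition hclass := {eq_quot homotopic_equiv}.
HB.instance Definition _ := Choice.on hclass.
HB.instance Definition _ := Quotient.on hclass.
HB.instance Definition _ := EqQuotient.on hclass.

Definition hcl (p : {path I from x to y}) : hclass := \pi_hclass p.

Lemma hclP (p q : {path I from x to y}) : hcl p = hcl q <-> path_homotopic p q.
Proof. by split=> [/eqmodP/asboolP|pq]//; apply/eqmodP/asboolP. Qed.

Lemma hcl_repr (c : hclass) : hcl (repr c) = c.
Proof. exact: reprK. Qed.

End classes.

Definition hmul (x y z : X) (c : hclass x y) (d : hclass y z) : hclass x z :=
  hcl (concat (repr c) (repr d)).

Definition hinv (x y : X) (c : hclass x y) : hclass y x :=
  hcl (reverse (repr c)).

Lemma hmulE (x y z : X) (p : {path I from x to y}) (q : {path I from y to z}) :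
  hmul (hcl p) (hcl q) = hcl (concat p q).
Proof. by apply/hclP/homotopic_concat; apply/hclP; rewrite hcl_repr. Qed.

Lemma hinvE (x y : X) (p : {path I from x to y}) :
  hinv (hcl p) = hcl (reverse p).
Proof. by apply/hclP/homotopic_reverse; apply/hclP; rewrite hcl_repr. Qed.

Lemma hmulA (w x y z : X) (a : hclass w x) (b : hclass x y) (c : hclass y z) :
  hmul a (hmul b c) = hmul (hmul a b) c.
Proof.
rewrite -(hcl_repr a) -(hcl_repr b) -(hcl_repr c) !hmulE.
exact/hclP/homotopic_concatA.
Qed.

Lemma hmul1 (x y : X) (a : hclass x y) : hmul a (hcl (const_path y)) = a.
Proof. by rewrite -(hcl_repr a) hmulE; exact/hclP/homotopic_concat1. Qed.

Lemma h1mul (x y : X) (a : hclass x y) : hmul (hcl (const_path x)) a = a.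
Proof. by rewrite -(hcl_repr a) hmulE; exact/hclP/homotopic_1concat. Qed.

Lemma hmulV (x y : X) (a : hclass x y) : hmul a (hinv a) = hcl (const_path x).
Proof. by rewrite -(hcl_repr a) hinvE hmulE; exact/hclP/homotopic_concatV. Qed.

Lemma hinvK (x y : X) (a : hclass x y) : hinv (hinv a) = a.
Proof. by rewrite -(hcl_repr a) !hinvE reverseK. Qed.

Lemma hVmul (x y : X) (a : hclass x y) : hmul (hinv a) a = hcl (const_path y).
Proof. by rewrite -{2}(hinvK a) hmulV. Qed.

Lemma hinvM (x y z : X) (a : hclass x y) (b : hclass y z) :
  hinv (hmul a b) = hmul (hinv b) (hinv a).
Proof.
have ab1 : hmul (hmul a b) (hmul (hinv b) (hinv a)) = hcl (const_path x).
  by rewrite hmulA -(hmulA a) hmulV hmul1 hmulV.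
by rewrite -[LHS]hmul1 -ab1 hmulA hVmul h1mul.
Qed.

End homotopy_class.

Definition pi1 (R : realType) (X : topologicalType) (x0 : X) : Type :=
  hclass (R := R) x0 x0.

HB.instance Definition _ (R : realType) (X : topologicalType) (x0 : X) :=
  Choice.on (pi1 R x0).
(* The product of [p] and [q] is [p . q], first p and then q. *)
HB.instance Definition _ (R : realType) (X : topologicalType) (x0 : X) :=
  isGroup.Build (pi1 R x0) (@hmulA R X x0 x0 x0 x0) (@h1mul R X x0 x0)
    (@hmul1 R X x0 x0) (@hVmul R X x0 x0) (@hmulV R X x0 x0).

Definition loop_class (R : realType) (X : topologicalType) (x0 : X)
  (p : {path unit_interval R from x0 to x0}) : pi1 R x0 := hcl p.

Definition based_path (R : realType) (X : topologicalType) (x0 : X) : Type :=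
  {x : X & {path unit_interval R from x0 to x}}.

HB.instance Definition _ (R : realType) (X : topologicalType) (x0 : X) :=
  Choice.on (based_path R x0).
HB.instance Definition _ (R : realType) (X : topologicalType) (x0 : X) :=
  isPointed.Build (based_path R x0) (Tagged _ (const_path x0)).

Section covering_space.
Context {R : realType} {X : topologicalType} {x0 : X}.
Local Notation I := (unit_interval R).
Local Open Scope quotient_scope.

Definition endpoint (a : based_path R x0) : X := tag a.

(* The path tagged a followed by g, as a path from x0. *)
Definition extend (a : based_path R x0) (y : X)
    (g : {path I from endpoint a to y}) : based_path R x0 :=
  Tagged _ (concat (tagged a) g).

Variable H : groupClosed (pi1 R x0).

(* The equality e of endpoints is part of the relation; path_cast only moves
   tagged b to the type of paths ending at endpoint a. *)
Definition same_point (a b : based_path R x0) : Prop :=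
  exists e : endpoint b = endpoint a,
    loop_class (concat (tagged a) (reverse (path_cast e (tagged b)))) \in H.

Definition same_point_rel (a b : based_path R x0) : bool := `[< same_point a b >].

Lemma same_pointE (x : X) (p q : {path I from x0 to x}) :
  same_point (Tagged _ p) (Tagged _ q) <->
  (hmul (hcl p) (hinv (hcl q)) : pi1 R x0) \in H.
Proof.
rewrite hinvE hmulE; split=> [[e]|pqH]; last by exists erefl.
by rewrite /= in e *; rewrite (Prop_irrelevance e erefl).
Qed.

Lemma same_point_refl : reflexive same_point_rel.
Proof. by move=> [x p]; apply/asboolP/same_pointE; rewrite hmulV; exact: gpred1. Qed.

Lemma same_point_symW a b : same_point a b -> same_point b a.
Proof.
move: a b => [x p] [y q] /[dup] -[/= e _]; case: x / e p => p.
move=> /same_pointE pq; apply/same_pointE.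
have -> : hmul (hcl q) (hinv (hcl p)) =
    ((hmul (hcl p) (hinv (hcl q)) : pi1 R x0)^-1)%g.
  by rewrite -[RHS]/(hinv _) hinvM hinvK.
exact: gpredVr.
Qed.

Lemma same_point_sym : symmetric same_point_rel.
Proof.
by move=> a b; apply/idP/idP => /asboolP ab; apply/asboolP/same_point_symW.
Qed.

Lemma same_point_trans : transitive same_point_rel.
Proof.
move=> [y q] [x p] [z r] /asboolP /[dup] -[/= e _]; case: x / e p => p.
move=> pq /asboolP /[dup] -[/= e _]; case: y / e p q pq => p q.
move=> /same_pointE pq /same_pointE qr; apply/asboolP/same_pointE.
have -> : hmul (hcl p) (hinv (hcl r)) =
    ((hmul (hcl p) (hinv (hcl q)) : pi1 R x0) * hmul (hcl q) (hinv (hcl r)))%g.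
  rewrite -[RHS]/(hmul _ _) hmulA -(hmulA (hcl p)) hVmul hmul1//.
exact: gpredM.
Qed.

Canonical same_point_equiv := EquivRel same_point_rel
  same_point_refl same_point_sym same_point_trans.

Definition Xtilde : Type := {eq_quot same_point_equiv}.
HB.instance Definition _ := Choice.on Xtilde.
HB.instance Definition _ := Quotient.on Xtilde.
HB.instance Definition _ := EqQuotient.on Xtilde.

Definition path_point (a : based_path R x0) : Xtilde := \pi_Xtilde a.

Lemma path_pointP (a b : based_path R x0) :
  path_point a = path_point b <-> same_point a b.
Proof. by split=> [/eqmodP/asboolP|ab]//; apply/eqmodP/asboolP. Qed.

Lemma path_point_repr (z : Xtilde) : path_point (repr z) = z.
Proof. exact: reprK. Qed.

Definition endpoint_proj (z : Xtilde) : X := endpoint (repr z).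

Lemma endpoint_projE (a : based_path R x0) :
  endpoint_proj (path_point a) = endpoint a.
Proof.
by have /path_pointP[] := path_point_repr (path_point a).
Qed.

Lemma path_point_extend (a b : based_path R x0) (e : endpoint b = endpoint a)
    (y : X) (g : {path I from endpoint a to y})
    (g' : {path I from endpoint b to y}) : g =1 g' ->
  path_point a = path_point b ->
  path_point (extend g) = path_point (extend g').
Proof.
move: a b e g g' => [x p] [x' p'] /= e; case: x / e p => p g g' gg'.
move/path_pointP/same_pointE => pp'; apply/path_pointP/same_pointE.
have -> : g = g' by apply/path_eqP.
by rewrite -!hmulE hinvM hmulA -(hmulA (hcl p)) hmulV hmul1.
Qed.

Lemma path_point_extend2 (a : based_path R x0) (y z : X)
    (g : {path I from endpoint a to y}) (h : {path I from y to z}) :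
  path_point (extend (h : {path I from endpoint (extend g) to z})) =
  path_point (extend (concat g h)).
Proof.
apply/path_pointP/same_pointE; rewrite -!hmulE hmulA hmulV.
exact: gpred1.
Qed.

Lemma path_point_extend1 (a : based_path R x0) :
  path_point (extend (const_path (endpoint a))) = path_point a.
Proof.
case: a => x p; apply/path_pointP/same_pointE.
by rewrite -!hmulE hmul1 hmulV; exact: gpred1.
Qed.

(* The basic set <a, U>; it is only used when U is open and contains the
   endpoint of a (see basic_index). *)
Definition basic (a : based_path R x0) (U : set X) : set Xtilde :=
  [set z | exists (y : X) (g : {path I from endpoint a to y}),
    range g `<=` U /\ z = path_point (extend g)].

Lemma basic_self (a : based_path R x0) (U : set X) :
  U (endpoint a) -> basic a U (path_point a).
Proof.
move=> Ua; exists (endpoint a), (const_path (endpoint a)); split.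
  by move=> _ [t _ <-].
by rewrite path_point_extend1.
Qed.

Lemma basic_sub (a b : based_path R x0) (U V : set X) :
  basic a U (path_point b) -> V `<=` U -> basic b V `<=` basic a U.
Proof.
move=> [y [g [gU bg]]] VU _ [z [h [hV ->]]].
have e : endpoint b = y.
  by rewrite -(endpoint_projE b) bg endpoint_projE.
case: y / e g bg gU => g bg gU.
exists z, (concat g h); split; last first.
  rewrite -path_point_extend2; exact: path_point_extend.
move=> _ [t _ <-]; rewrite /= /mk_path /concat_fun; case: ifP => _.
  exact: gU.
by apply/VU/hV.
Qed.

Definition basic_index : set (based_path R x0 * set X) :=
  [set aU | open aU.2 /\ aU.2 (endpoint aU.1)].

Lemma basic_cover :
  \bigcup_(aU in basic_index) basic aU.1 aU.2 = [set: Xtilde].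
Proof.
apply/seteqP; split=> // z _; exists (repr z, setT) => /=.
  by split => //; exact: openT.
by have := @basic_self (repr z) setT; rewrite path_point_repr; exact.
Qed.

Lemma basic_join (aU bV : based_path R x0 * set X) (z : Xtilde) :
  basic_index aU -> basic_index bV ->
  basic aU.1 aU.2 z -> basic bV.1 bV.2 z ->
  exists cW, [/\ basic_index cW, basic cW.1 cW.2 z &
    basic cW.1 cW.2 `<=` basic aU.1 aU.2 `&` basic bV.1 bV.2].
Proof.
have basic_end (a : based_path R x0) (U : set X) : basic a U z ->
    U (endpoint (repr z)).
  move=> [y [g [gU zE]]]; rewrite -/(endpoint_proj z) zE endpoint_projE.
  by apply: gU; exists one => //; exact: path_one.
move: aU bV => [a U] [b V] [/= oU Ua] [/= oV Vb] aUz bVz.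
exists (repr z, U `&` V); split => /=.
- split; first exact: openI.
  by split; [exact: basic_end aUz|exact: basic_end bVz].
- have := @basic_self (repr z) (U `&` V); rewrite path_point_repr; apply.
  by split; [exact: basic_end aUz|exact: basic_end bVz].
- by rewrite subsetI; split; apply: basic_sub; rewrite ?path_point_repr// => ? [].
Qed.

HB.instance Definition _ :=
  isBaseTopological.Build Xtilde basic_cover basic_join.

Lemma open_XtildeP (A : set Xtilde) : open A <->
  forall z, A z -> exists (a : based_path R x0) (U : set X),
    [/\ open U, U (endpoint a), basic a U z & basic a U `<=` A].
Proof.
split=> [[D sD <-] z [[a U] DaU aUz]|oA].
  have [/= oU Ua] := sD _ DaU; exists a, U; split => // z' az'.
  by exists (a, U).
exists [set aU | basic_index aU /\ basic aU.1 aU.2 `<=` A]; first by move=> aU [].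
apply/seteqP; split=> [z [[a U] [_ /=]]|z /oA[a [U [oU Ua aUz aUA]]]].
  by move=> sub az; exact: sub.
by exists (a, U).
Qed.

Lemma endpoint_proj_continuous : continuous endpoint_proj.
Proof.
apply/continuousP => U oU; apply/open_XtildeP => z Uz.
exists (repr z), U; split => //.
  by have := @basic_self (repr z) U; rewrite path_point_repr; apply.
move=> _ [y [g [gU ->]]]; rewrite /= endpoint_projE.
by apply: gU; exists one => //; exact: path_one.
Qed.

Definition fiber (x : X) : Type := set_type (endpoint_proj @^-1` [set x]).
HB.instance Definition _ (x : X) := Topological.on (fiber x).

Lemma open_fiberP (x : X) (A : set (fiber x)) :
  open A <-> exists2 B : set Xtilde, open B & @set_val _ _ @^-1` B = A.
Proof. by []. Qed.

Lemma fiberP (x : X) (z : fiber x) : endpoint (repr (set_val z)) = x.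
Proof. exact: set_valP z. Qed.

Definition in_fiber (x : X) (z : Xtilde) (zx : endpoint_proj z = x) : fiber x :=
  exist (fun z => z \in endpoint_proj @^-1` [set x]) z (mem_set zx).

(* Defined on a chosen representative; monodromyE shows that it sends <alpha> to
   <alpha . beta> for every representative alpha. *)
Definition monodromy (x y : X) (beta : {path I from x to y}) (z : fiber x) :
    fiber y :=
  in_fiber (endpoint_projE
    (Tagged _ (concat (path_cast (fiberP z) (tagged (repr (set_val z)))) beta))).

Lemma monodromyE (x y : X) (beta : {path I from x to y})
    (alpha : {path I from x0 to x}) (z : fiber x) :
  set_val z = path_point (Tagged _ alpha) ->
  set_val (monodromy beta z) = path_point (Tagged _ (concat alpha beta)).
Proof.
rewrite -{1}(path_point_repr (set_val z)).
have -> : set_val (monodromy beta z) = path_point (Tagged _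
    (concat (path_cast (fiberP z) (tagged (repr (set_val z)))) beta)) by [].
move: (fiberP z); move: (repr (set_val z)) => {z} [x' p] /= e.
case: x / e alpha beta => alpha beta zE.
exact: (@path_point_extend (Tagged _ p) (Tagged _ alpha) erefl).
Qed.

End covering_space.

Arguments path_point {R X x0} H a.
Arguments endpoint_proj {R X x0} H z.
Arguments monodromy {R X x0} H {x y} beta z.

Definition local_pi1 (R : realType) (X : topologicalType) (x0 x : X)
    (alpha : {path unit_interval R from x0 to x}) (U : set X) : set (pi1 R x0) :=
  [set c | exists delta : {path unit_interval R from x to x},
    range delta `<=` U /\
    c = loop_class (concat (concat alpha delta) (reverse alpha))].

Definition locally_quasinormal (R : realType) (X : topologicalType) (x0 : X)
    (H : groupClosed (pi1 R x0)) : Prop :=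
  forall (x : X) (alpha : {path unit_interval R from x0 to x}) (U : set X),
    open U -> U x ->
    exists V : set X, [/\ open V, V x, V `<=` U &
      [set (h * c)%g | h in [set` H] & c in local_pi1 alpha V] =
      [set (c * h)%g | c in local_pi1 alpha V & h in [set` H]]].

Definition path_connected (R : realType) (X : topologicalType) (A : set X) :
    Prop :=
  forall x y : X, A x -> A y ->
    exists p : {path unit_interval R from x to y}, range p `<=` A.

Definition locally_path_connected (R : realType) (X : topologicalType) : Prop :=
  forall (x : X) (U : set X), open U -> U x ->
    exists V : set X, [/\ open V, V x, V `<=` U & path_connected R V].

Definition hurewicz_fibration (R : realType) (E B : topologicalType)
    (p : E -> B) : Prop :=
  forall (Y : topologicalType) (f : Y -> E) (F : Y * unit_interval R -> B),
    continuous f -> continuous F -> (forall y, p (f y) = F (y, zero)) ->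
    exists G : Y * unit_interval R -> E,
      [/\ continuous G, forall z, p (G z) = F z & forall y, G (y, zero) = f y].

(* Main.v *)
Require Import Defs.
From mathcomp Require Import all_boot all_order all_algebra.
From mathcomp Require Import all_classical reals topology homotopy.
From mathcomp Require Import normedtype lra.

(** The lift of a homotopy [F] starting at [f] is the natural one: if [f y] is
    the class of a path [a y], then [(y, t)] goes to the class of [a y]
    followed by the track of [y] under [F] up to time [t]. It lies over
    [F] and extends [f] by construction, so the whole content is continuity,
    and since moving [t] a little only appends a short piece of track, the
    point is to compare, at a fixed time [t0], the lifts of [y] and of a nearby
    [y0].

    Write [L y t] for the homotopy class of [a y] followed by the track of [y],
    and let [U] be an open neighbourhood of [F (y0, t0)]. Local quasinormality
    lets one shrink [U] so that the set [K] of products of an element of [H]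
    and an element of [pi (L y0 t0, U)] is closed under multiplication. It
    suffices that, for [y] near [y0] and for a short path [g] joining
    [F (y0, t0)] to [F (y, t0)], the loop [L y t0 . g^- . (L y0 t0)^-] has its
    class in [K]: such a class is that of [h . L y0 t0 . d . (L y0 t0)^-] with
    [h] in [H] and [d] a loop in [U], and hence [L y t0] and [L y0 t0 . d . g]
    represent the same point of the covering space.

    This membership ([comparable]) makes sense at every time [s], with the same
    [K], and it is a locally constant property of [s]. Indeed, continuity of
    the monodromy along the track of [y0] from [s] to [t0] says precisely that
    [K] contains [pi (L y0 s, V)] for some neighbourhood [V] of [F (y0, s)]
    ([monodromy_coset_loops]). This inclusion persists for all times whose
    tracks stay in [V], because [pi (L y0 s, V)] does not change when the base
    path is prolonged inside [V] ([local_loops_move]). Going from [s] to a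
    nearby [s'] multiplies the class by that of a loop which leaves along
    [L y0 s], runs once around a small quadrilateral in [V] and returns, so [K]
    absorbs the change ([comparable_locally_constant]). At time 0 the property
    is the continuity of [f] ([comparable_zero]), and the unit interval is
    connected, so it holds at time [t0]. Keeping one and the same [K] is what
    avoids a subdivision of the interval whose pieces would depend on the
    neighbourhoods chosen along it.

    All computations take place in the fundamental groupoid ([hmul], [hinv] on
    [hclass]), where the associativity needed to cancel tracks is an
    equality. *)

Set Implicit Arguments.
Unset Strict Implicit.
Unset Printing Implicit Defensive.

Import Order.TTheory GRing.Theory Num.Theory.
Import numFieldTopology.Exports numFieldNormedType.Exports.

Local Open Scope classical_set_scope.
Local Open Scope ring_scope.

(** * Connectedness and neighbourhoods in the unit interval *)

Section interval.
Context {R : realType}.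
Local Notation I := (unit_interval R).

Lemma unit_interval_connected : connected [set: I].
Proof.
have -> : [set: I] = @clamp R @` `[0, 1].
  apply/seteqP; split=> // t _; exists (ival t); last exact: ivalK.
  by rewrite /= in_itv /= ival_ge0 ival_le1.
apply: connected_continuous_connected; first exact: segment_connected.
exact: continuous_subspaceT (@clamp_continuous R).
Qed.

(** The set where a locally constant property holds is both open and closed,
    and the interval is connected. *)
Lemma unit_interval_locally_constant (P : I -> Prop) :
  (forall t : I, exists2 J : set I, nbhs t J &
     forall s s', J s -> J s' -> P s -> P s') ->
  forall s t, P s -> P t.
Proof.
move=> Ploc s t Ps.
have oP : open [set u | P u].
  rewrite openE => u Pu; have [J nJ PJ] := Ploc u.
  have Ju := nbhs_singleton nJ.
  by apply: filterS nJ => v Jv; exact: (PJ u).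
have cP : closed [set u | P u].
  move=> u clu; have [J nJ PJ] := Ploc u.
  have Ju := nbhs_singleton nJ.
  by have [v [Pv Jv]] := clu _ nJ; exact: PJ Pv.
suff E : [set u | P u] = [set: I] by rewrite -[P t]/([set u | P u] t) E.
apply: unit_interval_connected; first by exists s.
- by exists [set u | P u] => //; rewrite setTI.
- by exists [set u | P u] => //; rewrite setTI.
Qed.

(** Balls are used instead of arbitrary neighbourhoods because they are
    convex: a track between two parameters of a ball stays over that ball. *)
Lemma nbhs_unit_interval_ball (t : I) (J : set I) : nbhs t J ->
  exists2 e : R, 0 < e & forall s : I, `|ival s - ival t| < e -> J s.
Proof.
move=> nJ; have : nbhs (ival t) (@clamp R @^-1` J).
  have nJ' : nbhs (clamp (ival t)) J by rewrite ivalK.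
  exact: (@clamp_continuous R (ival t)) nJ'.
move=> /nbhs_ballP[e /= e0 eJ]; exists e => // s st.
by rewrite -(ivalK s); apply: eJ; rewrite /ball /= distrC.
Qed.

Lemma unit_interval_ball_nbhs (t : I) (e : R) : 0 < e ->
  nbhs t [set s : I | `|ival s - ival t| < e].
Proof.
move=> e0.
have : nbhs t (@ival R @^-1` ball (ival t) e).
  exact: (@ival_continuous R t _ (nbhsx_ballx (ival t) e e0)).
by apply: filterS => s; rewrite /ball /= distrC.
Qed.

End interval.

(** * The track of a curve between two parameters *)

Section segment.
Context {R : realType} {X : topologicalType}.
Local Notation I := (unit_interval R).
Variable (r : I -> X).
Hypothesis cr : continuous r.

(** The affine parametrisation from [s] to [t], whatever their order; the
    clamping only serves to land in the subtype. *)
Definition between (s t u : I) : I :=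
  clamp (ival s + ival u * (ival t - ival s)).

Lemma between_continuous s t : continuous (between s t).
Proof.
apply: clamp_comp_continuous => u.
apply: (@continuousD R R^o I (cst (ival s)) (fun u => ival u * (ival t - ival s))).
  exact: cst_continuous.
apply: (@continuousM R I (@ival R) (cst (ival t - ival s))).
  exact: ival_continuous.
exact: cst_continuous.
Qed.

Lemma segment_continuous s t : continuous (r \o between s t).
Proof. exact: comp_continuous (@between_continuous s t) cr. Qed.

Lemma segment_zero s t : (r \o between s t) zero = r s.
Proof. by rewrite /= /between ival_zero mul0r addr0 ivalK. Qed.

Lemma segment_one s t : (r \o between s t) one = r t.
Proof. by rewrite /= /between ival_one mul1r addrC subrK ivalK. Qed.

Definition segment s t : {path I from r s to r t} :=
  mk_path (@segment_continuous s t) (segment_zero s t) (segment_one s t).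

Lemma segment_refl s : hcl (segment s s) = hcl (const_path (r s)).
Proof.
apply/hclP/homotopic_refl => u.
by rewrite /= /mk_path /= /between subrr mulr0 addr0 ivalK.
Qed.

(** Both sides reparametrise the same curve [r], along a broken line ([phi])
    and along a straight one ([psi]). Since [s], [t] and [u] need not be in
    increasing order, this also gives the inverse of a track. *)
Lemma segment_mul s t u :
  hmul (hcl (segment s t)) (hcl (segment t u)) = hcl (segment s u).
Proof.
rewrite hmulE; apply/hclP.
pose phi (v : I) : R := ival s + Num.min (2 * ival v) 1 * (ival t - ival s)
  + Num.max 0 (2 * ival v - 1) * (ival u - ival t).
pose psi (v : I) : R := ival s + ival v * (ival u - ival s).
have cI := @ival_continuous R.
have cc (c : R) : continuous (cst c : I -> R) by exact: cst_continuous.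
have cD (f g : I -> R) : continuous f -> continuous g ->
    continuous (fun v => f v + g v).
  by move=> cf cg v; apply: (@continuousD R R^o I f g) => //; [exact: cf|exact: cg].
have cM (f g : I -> R) : continuous f -> continuous g ->
    continuous (fun v => f v * g v).
  by move=> cf cg v; apply: (@continuousM R I f g); [exact: cf|exact: cg].
have c2 : continuous (fun v : I => 2 * ival v) by exact: cM (cc 2) cI.
have cphi : continuous phi.
  apply: (cD _ _ (cD _ _ (cc _) _)); apply: (cM _ _ _ (cc _)).
    move=> v; apply: (@continuous_min R I (fun v => 2 * ival v) (cst 1)).
      exact: c2.
    exact: cc.
  move=> v; apply: (@continuous_max R I (cst 0) (fun v => 2 * ival v - 1)).
    exact: cc.
  exact: (cD _ _ c2 (cc (- 1))).
have cpsi : continuous psi by exact: cD _ _ (cc _) (cM _ _ cI (cc _)).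
apply: (homotopic_reparam cr cphi cpsi) => [||v|//].
- by rewrite /phi /psi ival_zero min_l ?max_l; lra.
- by rewrite /phi /psi ival_one min_r ?max_r; lra.
have v0 := ival_ge0 v; have v1 := ival_le1 v.
rewrite /= /mk_path /concat_fun /phi; case: (leP (ival v) 2^-1) => v2.
  rewrite /= /mk_path /= /between; congr (r (clamp _)).
  by rewrite clampK ?min_l ?max_l; lra.
rewrite /= /mk_path /= /between; congr (r (clamp _)).
by rewrite clampK ?min_r ?max_r; lra.
Qed.

Lemma segment_range s t (e : I) (d : R) :
  `|ival s - ival e| < d -> `|ival t - ival e| < d ->
  forall u, `|ival (between s t u) - ival e| < d.
Proof.
have s0 := ival_ge0 s; have s1 := ival_le1 s.
have t0 := ival_ge0 t; have t1 := ival_le1 t.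
move=> se te u; move: se te; rewrite !ltr_norml => /andP[es se] /andP[et te].
have u0 := ival_ge0 u; have u1 := ival_le1 u.
have [st|ts] := leP (ival s) (ival t).
  have : 0 <= ival u * (ival t - ival s) <= ival t - ival s by nra.
  by move=> /andP[? ?]; rewrite clampK; lra.
have : ival t - ival s <= ival u * (ival t - ival s) <= 0 by nra.
by move=> /andP[? ?]; rewrite clampK; lra.
Qed.

End segment.

(** * Homotopy classes of paths inside a set *)

Section groupoid.
Context {R : realType} {X : topologicalType}.
Local Notation I := (unit_interval R).
Local Notation hclass := (hclass (R := R)).

Lemma hmulVK (x y z : X) (a : hclass x y) (b : hclass y z) :
  hmul (hmul a b) (hinv b) = a.
Proof. by rewrite -hmulA hmulV hmul1. Qed.

Lemma hmulKV (x y z : X) (a : hclass x y) (b : hclass z y) :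
  hmul (hmul a (hinv b)) b = a.
Proof. by rewrite -hmulA hVmul hmul1. Qed.

(** Cancellation behind the passage from one time to another: [p] and [q] are
    lifts at the old time, [g] and [g'] join them at the old and new times,
    [u] and [v] are tracks. *)
Lemma hmul_drift (w x y z t : X) (p : hclass w x) (q : hclass w y)
    (g : hclass y x) (u : hclass x z) (g' : hclass t z) (v : hclass t y) :
  hmul (hmul (hmul p (hinv g)) (hinv q))
    (hmul (hmul q (hmul (hmul (hmul g u) (hinv g')) v)) (hinv q)) =
  hmul (hmul (hmul p u) (hinv g')) (hinv (hmul q (hinv v))).
Proof. by rewrite !hmulA !hmulKV hinvM hinvK !hmulA. Qed.

Definition hclass_in (U : set X) (x y : X) (c : hclass x y) : Prop :=
  exists2 p : {path I from x to y}, range p `<=` U & c = hcl p.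

Lemma hclass_in_mul (U : set X) (x y z : X) (c : hclass x y) (d : hclass y z) :
  hclass_in U c -> hclass_in U d -> hclass_in U (hmul c d).
Proof.
move=> [p pU ->] [q qU ->]; exists (concat p q); last by rewrite hmulE.
move=> _ [t _ <-]; rewrite /= /mk_path /concat_fun.
by case: ifP => _; [apply: pU|apply: qU].
Qed.

Lemma hclass_in_inv (U : set X) (x y : X) (c : hclass x y) :
  hclass_in U c -> hclass_in U (hinv c).
Proof.
move=> [p pU ->]; exists (reverse p); last by rewrite hinvE.
by move=> _ [t _ <-]; apply: pU.
Qed.

Lemma hclass_in_sub (U V : set X) (x y : X) (c : hclass x y) :
  U `<=` V -> hclass_in U c -> hclass_in V c.
Proof. by move=> UV [p pU ->]; exists p => //; exact: subset_trans UV. Qed.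

Lemma hclass_in_segment (U : set X) (r : I -> X) (cr : continuous r)
    (e : I) (d : R) (s t : I) :
  (forall u, `|ival u - ival e| < d -> U (r u)) ->
  `|ival s - ival e| < d -> `|ival t - ival e| < d ->
  hclass_in U (hcl (segment cr s t)).
Proof.
move=> rU sd td; exists (segment cr s t) => // _ [u _ <-].
exact/rU/segment_range.
Qed.

Lemma locally_path_connected_class (x : X) (U : set X) :
  locally_path_connected R X -> open U -> U x ->
  exists V : set X, [/\ open V, V x, V `<=` U &
    forall y, V y -> exists c : hclass x y, hclass_in V c].
Proof.
move=> Xlpc oU Ux; have [V [oV Vx VU Vpc]] := Xlpc x U oU Ux.
exists V; split => // y Vy; have [p pV] := Vpc x y Vx Vy.
by exists (hcl p), p.
Qed.

End groupoid.

(** * Local subgroups of the fundamental group *)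

Section local_groups.
Context {R : realType} {X : topologicalType} {x0 : X}.
Local Notation I := (unit_interval R).
Local Notation hclass := (hclass (R := R)).

(** [local_loops a U] is [local_pi1] for a homotopy class [a] of paths. *)
(** The subgroup [local_pi1], depending only on the homotopy class of the
    base path, so that it can be computed with in the groupoid. *)
Definition local_loops (x : X) (a : hclass x0 x) (U : set X) : set (pi1 R x0) :=
  [set c | exists2 d : hclass x x, hclass_in U d & c = hmul (hmul a d) (hinv a)].

Lemma local_pi1E (x : X) (p : {path I from x0 to x}) (U : set X) :
  local_pi1 p U = local_loops (hcl p) U.
Proof.
apply/seteqP; split=> c.
  move=> [d [dU ->]]; exists (hcl d); first by exists d.
  by rewrite hinvE !hmulE.
move=> [_ [d dU ->] ->]; exists d; split => //.
by rewrite hinvE !hmulE.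
Qed.

Lemma local_loops_mul (x : X) (a : hclass x0 x) (U : set X) (c d : pi1 R x0) :
  local_loops a U c -> local_loops a U d -> local_loops a U (c * d)%g.
Proof.
move=> [c' c'U ->] [d' d'U ->]; exists (hmul c' d').
  exact: hclass_in_mul.
rewrite -[LHS]/(hmul _ _) !hmulA hmulKV//.
Qed.

(** Conjugating a loop in [U] by a path in [U] gives a loop in [U]. As the
    path can be run backwards, the local group is thus the same at both ends. *)
Lemma local_loops_move (x y : X) (a : hclass x0 x) (g : hclass x y)
    (U : set X) : hclass_in U g ->
  local_loops (hmul a g) U `<=` local_loops a U.
Proof.
move=> gU _ [d dU ->]; exists (hmul (hmul g d) (hinv g)).
  by apply: hclass_in_mul; [exact: hclass_in_mul|exact: hclass_in_inv].
by rewrite hinvM !hmulA.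
Qed.

Variable H : groupClosed (pi1 R x0).

(** These are the classes [c] such that [c . a] represents a point of the
    basic set around the point of [a], when [U] is a neighbourhood of its
    endpoint. *)
Definition coset_loops (x : X) (a : hclass x0 x) (U : set X) : set (pi1 R x0) :=
  [set (h * c)%g | h in [set` H] & c in local_loops a U].

Lemma coset_loopsMl (x : X) (a : hclass x0 x) (U : set X) (h c : pi1 R x0) :
  h \in H -> coset_loops a U c -> coset_loops a U (h * c)%g.
Proof.
move=> hH [h' /= h'H [c' c'U <-]]; exists (h * h')%g; first exact: gpredM.
by exists c' => //; rewrite mulgA.
Qed.

Lemma sub_coset_loops (x : X) (a : hclass x0 x) (U : set X) :
  local_loops a U `<=` coset_loops a U.
Proof. by move=> c cU; exists 1%g; [exact: gpred1|exists c => //; rewrite mul1g]. Qed.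

(** In a product of two elements, the inner factors [c1] and [h2] can be
    exchanged by quasinormality, and then each kind of factor is collected. *)
Lemma locally_quasinormal_coset_loops (x : X) (a : hclass x0 x) (U : set X) :
  locally_quasinormal H -> open U -> U x ->
  exists V : set X, [/\ open V, V x, V `<=` U & forall c d,
    coset_loops a V c -> coset_loops a V d -> coset_loops a V (c * d)%g].
Proof.
move=> Hlqn oU Ux; have [V [oV Vx VU]] := Hlqn x (repr a) U oU Ux.
rewrite local_pi1E hcl_repr => HV; exists V; split => // c d.
move=> [h1 h1H [c1 c1V <-]] [h2 h2H [c2 c2V <-]].
have : coset_loops a V (c1 * h2)%g.
  by rewrite /coset_loops HV; exists c1 => //; exists h2.
move=> [h3 h3H [c3 c3V e]]; exists (h1 * h3)%g; first exact: gpredM.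
exists (c3 * c2)%g; first exact: local_loops_mul.
by rewrite !mulgA -(mulgA h1 h3) e !mulgA.
Qed.

(** This is continuity of the monodromy along [b] at the point of [a], read
    through the definition of the topology: a loop [d] in a small [V] moves
    that point to a nearby one, whose image must be the point of [a . b . g]
    for a small loop [g]. Comparing the two descriptions of the image puts
    [a . d . b . (a . b . g)^-] in [H]. *)
Lemma monodromy_coset_loops (x y : X) (b : hclass x y) (a : hclass x0 x)
    (U : set X) :
  (forall beta : {path I from x to y},
    continuous (monodromy H beta : fiber H x -> fiber H y)) ->
  open U -> U y ->
  exists V : set X, [/\ open V, V x &
    local_loops a V `<=` coset_loops (hmul a b) U].
Proof.
move=> mcont oU Uy.
rewrite -(hcl_repr a) -(hcl_repr b) hmulE.
move: (repr a) (repr b) => alpha beta.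
pose z : fiber H x := in_fiber (endpoint_projE H (Tagged _ alpha)).
pose ab : based_path R x0 := Tagged _ (concat alpha beta).
pose B : set (fiber H y) := set_val @^-1` (basic (H := H) ab U).
(* The basic set around the image point is open in the whole space, so it
   cuts out an open set of the fiber to which continuity applies. *)
have oB : open B.
  apply/open_fiberP; exists (basic (H := H) ab U) => //.
  apply/open_XtildeP => w abw; exists ab, U; split => //.
have zE : set_val z = path_point H (Tagged _ alpha) by [].
have Bz : B (monodromy H beta z).
  rewrite /B /= (monodromyE beta zE); exact: basic_self.
have oA : open (monodromy H beta @^-1` B).
  by apply: open_comp oB => w _; exact: mcont.
have /open_fiberP[C oC CE] := oA.
have Cz : C (set_val z) by rewrite -[C _]/((set_val @^-1` C) z) CE.
have [c [V [oV Vc cVz cVC]]] := (open_XtildeP C).1 oC _ Cz.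
have Vx : V x.
  have [w [g [gV]]] := cVz; rewrite zE => /(congr1 (endpoint_proj H)).
  by rewrite !endpoint_projE /= => ->; apply: gV; exists one => //; exact: path_one.
exists V; split => // _ [_ [d dV ->] ->].
have CV : C (path_point H (Tagged _ (concat alpha d))).
  apply: cVC; rewrite zE in cVz.
  by apply: (basic_sub cVz (fun _ v => v)); exists x, d.
pose zd : fiber H x := in_fiber (endpoint_projE H (Tagged _ (concat alpha d))).
have zdE : set_val zd = path_point H (Tagged _ (concat alpha d)) by [].
have : B (monodromy H beta zd).
  by rewrite -[B _]/((monodromy H beta @^-1` B) zd) -CE /= zdE.
rewrite /B /= (monodromyE beta zdE) => -[y' [g [gU e]]].
have /= ey := congr1 (endpoint_proj H) e; rewrite !endpoint_projE /= in ey.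
case: y' / ey g gU e => g gU /path_pointP/same_pointE.
rewrite -!hmulE !hinvM => gH; eexists; first exact: gH.
exists (hmul (hmul (hmul (hcl alpha) (hcl beta)) (hcl g))
  (hinv (hmul (hcl alpha) (hcl beta)))).
  by exists (hcl g) => //; exists g.
by rewrite -[LHS]/(hmul _ _) hinvM !hmulA !(hmulKV, hmulVK).
Qed.

End local_groups.

(** * Points of the covering space as homotopy classes *)

Section class_point.
Context {R : realType} {X : topologicalType} {x0 : X}.
Local Notation I := (unit_interval R).
Local Notation hclass := (hclass (R := R)).
Variable H : groupClosed (pi1 R x0).

Definition class_point (x : X) (c : hclass x0 x) : Xtilde H :=
  path_point H (Tagged _ (repr c)).

Lemma class_pointP (x : X) (c d : hclass x0 x) :
  class_point c = class_point d <-> (hmul c (hinv d) : pi1 R x0) \in H.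
Proof.
split=> [/path_pointP/same_pointE|cdH]; first by rewrite !hcl_repr.
by apply/path_pointP/same_pointE; rewrite !hcl_repr.
Qed.

Lemma class_point_hcl (x : X) (p : {path I from x0 to x}) :
  class_point (hcl p) = path_point H (Tagged _ p).
Proof. by apply/path_pointP/same_pointE; rewrite hcl_repr hmulV; exact: gpred1. Qed.

(** Prolonging on the right does not interfere with the left action of [H]. *)
Lemma class_point_mul (x y : X) (c d : hclass x0 x) (g : hclass x y) :
  class_point c = class_point d ->
  class_point (hmul c g) = class_point (hmul d g).
Proof.
by move=> /class_pointP cd; apply/class_pointP; rewrite hinvM !hmulA hmulVK.
Qed.

Lemma endpoint_class_point (x : X) (c : hclass x0 x) :
  endpoint_proj H (class_point c) = x.
Proof. by rewrite endpoint_projE. Qed.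

Lemma basic_class (x : X) (p : {path I from x0 to x}) (U : set X) (z : Xtilde H) :
  basic (Tagged _ p) U z <->
  exists y (g : hclass x y), hclass_in U g /\ z = class_point (hmul (hcl p) g).
Proof.
split=> [[y [g [gU ->]]]|[y [_ [[g gU ->] ->]]]].
  by exists y, (hcl g); split; [exists g|rewrite hmulE class_point_hcl].
by exists y, g; split => //; rewrite hmulE class_point_hcl.
Qed.

Lemma nbhs_class_point (x : X) (c : hclass x0 x) (U : set X) :
  open U -> U x ->
  nbhs (class_point c) [set z | exists y (g : hclass x y),
    hclass_in U g /\ z = class_point (hmul c g)].
Proof.
move=> oU Ux; have -> : [set z | exists y (g : hclass x y),
    hclass_in U g /\ z = class_point (hmul c g)] =
    basic (H := H) (Tagged _ (repr c)) U.
  by apply/seteqP; split=> z; rewrite basic_class hcl_repr.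
apply: open_nbhs_nbhs; split; last exact: basic_self.
by apply/open_XtildeP => z cz; exists (Tagged _ (repr c)), U; split.
Qed.

Lemma class_point_nbhs (x : X) (c : hclass x0 x) (A : set (Xtilde H)) :
  nbhs (class_point c) A -> exists U : set X, [/\ open U, U x &
    forall y (g : hclass x y), hclass_in U g -> A (class_point (hmul c g))].
Proof.
rewrite nbhsE => -[B [oB Bc] BA].
have [a [U [oU Ua aUc aUB]]] := (open_XtildeP B).1 oB _ Bc.
have Ux : U x.
  have [w [g [gU]]] := aUc => /(congr1 (endpoint_proj H)).
  by rewrite !endpoint_projE /= => ->; apply: gU; exists one => //; exact: path_one.
exists U; split => // y g gU; apply/BA/aUB/(basic_sub aUc (fun _ u => u)).
by apply/basic_class; exists y, g; rewrite hcl_repr.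
Qed.

End class_point.

(** * Lifting a homotopy *)

Section lifting.
Context {R : realType} {X : topologicalType} {x0 : X}.
Local Notation I := (unit_interval R).
Local Notation hclass := (hclass (R := R)).
Variables (H : groupClosed (pi1 R x0)) (Y : topologicalType) (F : Y * I -> X).
Hypothesis cF : continuous F.
Variable a : forall y, hclass x0 (F (y, zero)).
Hypothesis ca : continuous (fun y => class_point H (a y)).

Lemma slice_continuous y : continuous (fun t => F (y, t)).
Proof.
apply: (comp_continuous (f := fun t : I => (y, t))) => //.
apply: pair_continuous; last by move=> t; exact: cvg_id.
exact: cst_continuous.
Qed.

Definition track y s t : hclass (F (y, s)) (F (y, t)) :=
  hcl (segment (@slice_continuous y) s t).

(** The candidate lift, as a homotopy class; its values in the covering space
    are the points of these classes. *)
Definition lift y t : hclass x0 (F (y, t)) := hmul (a y) (track y zero t).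

Lemma lift0 y : lift y zero = a y.
Proof. by rewrite /lift /track segment_refl hmul1. Qed.

Lemma lift_track y s t : hmul (lift y s) (track y s t) = lift y t.
Proof. by rewrite /lift -hmulA segment_mul. Qed.

Lemma track_inv y s t : hinv (track y s t) = track y t s.
Proof.
rewrite -[LHS]hmul1 -(segment_refl (@slice_continuous y)) -(segment_mul _ _ t).
by rewrite hmulA hVmul h1mul.
Qed.

(** Continuity of the homotopy, in the form of a box whose time side is
    convex. *)
Lemma tube (V : set X) (y0 : Y) (t0 : I) : open V -> V (F (y0, t0)) ->
  exists (N : set Y) (e : R), [/\ nbhs y0 N, 0 < e &
    forall y s, N y -> `|ival s - ival t0| < e -> V (F (y, s))].
Proof.
move=> oV Vx.
have [[N J] /= [nN nJ] NJ] := cF (open_nbhs_nbhs (conj oV Vx)).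
have [e e0 eJ] := nbhs_unit_interval_ball nJ.
exists N, e; split => // y s Ny se; apply: (NJ (y, s)).
by split => //; exact: eJ.
Qed.

(** The lifts of [y0] and of its neighbours at time [s] differ by an element
    of [K], once their endpoints are joined by a path close to [F (y0, s)].
    The condition bears on all such joining paths, and [W] is not asked to be
    path connected; its existence is settled separately, by shrinking [W]. *)
Definition comparable (K : set (pi1 R x0)) (y0 : Y) (s : I) : Prop :=
  exists W : set X, [/\ open W, W (F (y0, s)) &
    \forall y \near y0, forall g : hclass (F (y0, s)) (F (y, s)),
      hclass_in W g -> K (hmul (hmul (lift y s) (hinv g)) (hinv (lift y0 s)))].

Hypothesis X_lpc : locally_path_connected R X.

(** Passing from [s] to [s'] changes the comparison class by the loop [d]: a
    quadrilateral made of the two joining paths and of the tracks of [y] and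
    [y0], all inside [V]. *)
Lemma comparable_locally_constant (K : set (pi1 R x0)) (y0 : Y) (t : I)
    (V : set X) :
  (forall c d, K c -> K d -> K (c * d)%g) -> open V -> V (F (y0, t)) ->
  local_loops (lift y0 t) V `<=` K ->
  exists2 J : set I, nbhs t J & forall s s', J s -> J s' ->
    comparable K y0 s -> comparable K y0 s'.
Proof.
move=> KM oV Vt VK; have [N [e [nN e0 NV]]] := tube oV Vt.
exists [set s : I | `|ival s - ival t| < e]; first exact: unit_interval_ball_nbhs.
move=> s s' /= se s'e [W [oW Ws Wnear]].
have Ny0 : N y0 := nbhs_singleton nN.
have trackV y r r' : N y -> `|ival r - ival t| < e -> `|ival r' - ival t| < e ->
    hclass_in V (track y r r').
  by move=> Ny re r'e; apply: hclass_in_segment re r'e => u; exact: NV.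
have te : `|ival t - ival t| < e by rewrite subrr normr0.
(* Some joining path at time [s] is needed to apply the assumption there: it
   must lie in [W], and in [V] for the quadrilateral to be small. *)
have [W0 [oW0 W0s W0WV W0c]] := locally_path_connected_class X_lpc (openI oW oV)
  (conj Ws (NV _ _ Ny0 se)).
exists V; split => //; first exact: NV.
have near0 : \forall y \near y0, W0 (F (y, s)).
  have [N0 [e' [nN0 e'0 NW0]]] := tube oW0 W0s.
  apply: filterS nN0 => y N0y; apply: NW0 => //.
  by rewrite subrr normr0.
near=> y => g' g'V.
have [g gW0] : exists g : hclass (F (y0, s)) (F (y, s)), hclass_in W0 g.
  by apply: W0c; near: y.
have Ny : N y by near: y.
have Kg : K (hmul (hmul (lift y s) (hinv g)) (hinv (lift y0 s))).
  have Wy : forall g : hclass (F (y0, s)) (F (y, s)), hclass_in W g ->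
      K (hmul (hmul (lift y s) (hinv g)) (hinv (lift y0 s))) by near: y.
  by apply: Wy; apply: hclass_in_sub gW0 => x /W0WV[].
have gV : hclass_in V g by apply: hclass_in_sub gW0 => x /W0WV[].
pose d := hmul (hmul (hmul g (track y s s')) (hinv g')) (track y0 s' s).
have dV : hclass_in V d.
  by do !apply: hclass_in_mul => //; [exact: trackV|exact: hclass_in_inv|exact: trackV].
have Kd : K (hmul (hmul (lift y0 s) d) (hinv (lift y0 s))).
  (* [V] is adapted to the base path at time [t], the loop is based at time
     [s]. *)
  apply: VK; apply: (local_loops_move (trackV y0 t s Ny0 te se)).
  by rewrite lift_track; exists d.
by have := KM _ _ Kg Kd; rewrite [(_ * _)%g]hmul_drift track_inv !lift_track.
Unshelve. all: by end_near. Qed.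

(** Continuity of the initial lift makes it, for [y] near [y0], the point of
    [a y0 . g] with [g] small; any other small joining path [k] then differs
    from [g] by a small loop. *)
Lemma comparable_zero (K : set (pi1 R x0)) (y0 : Y) (V : set X) :
  (forall h c, h \in H -> K c -> K (h * c)%g) ->
  open V -> V (F (y0, zero)) ->
  local_loops (lift y0 zero) V `<=` K -> comparable K y0 zero.
Proof.
move=> HK oV V0 VK; exists V; split => //.
have := ca (nbhs_class_point H (a y0) oV V0); rewrite /nbhs/= => nV.
apply: filterS nV => y /= [x [g [gV e]]] k kV.
have ex : F (y, zero) = x.
  by have := congr1 (endpoint_proj H) e; rewrite !endpoint_class_point.
(* The endpoint of [g] is only propositionally [F (y, zero)]; eliminating
   the equality lets [g] be compared with [k]. *)
case: x / ex g gV e => g gV /class_pointP e.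
rewrite !lift0 in VK *.
have -> : hmul (hmul (a y) (hinv k)) (hinv (a y0)) =
   ((hmul (a y) (hinv (hmul (a y0) g)) : pi1 R x0) *
    hmul (hmul (a y0) (hmul g (hinv k))) (hinv (a y0)))%g.
  by rewrite -[RHS]/(hmul _ _) hinvM !hmulA !hmulKV.
apply: HK => //; apply: VK; exists (hmul g (hinv k)) => //.
by apply: hclass_in_mul => //; exact: hclass_in_inv.
Qed.

Hypothesis H_lqn : locally_quasinormal H.
Hypothesis monodromy_cont :
  forall (x y : X) (beta : {path I from x to y}),
    continuous (monodromy H beta : fiber H x -> fiber H y).

(** Continuity in the parameter at a fixed time, where both hypotheses on [H]
    are used: the comparison at time zero is transported to time [t0]. *)
Lemma lift_near (y0 : Y) (t0 : I) (U : set X) : open U -> U (F (y0, t0)) ->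
  \forall y \near y0, exists2 g : hclass (F (y0, t0)) (F (y, t0)),
    hclass_in U g & class_point H (lift y t0) = class_point H (hmul (lift y0 t0) g).
Proof.
move=> oU Ux.
have [V [oV Vx VU KM]] :=
  locally_quasinormal_coset_loops (lift y0 t0) H_lqn oU Ux.
set K := coset_loops H (lift y0 t0) V in KM.
have Kloc t : exists W : set X, [/\ open W, W (F (y0, t)) &
    local_loops (lift y0 t) W `<=` K].
  rewrite /K -(lift_track y0 t t0).
  exact: monodromy_coset_loops (track y0 t t0) _ _ _ oV Vx.
have : comparable K y0 t0.
  apply: (@unit_interval_locally_constant _ _ _ zero) => [t|].
    have [W [oW Wt WK]] := Kloc t.
    exact: comparable_locally_constant KM oW Wt WK.
  have [W [oW Wt WK]] := Kloc zero.
  by apply: comparable_zero oW Wt WK => h c; exact: coset_loopsMl.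
move=> [W [oW Wx Wnear]].
have [W0 [oW0 W0x W0WU W0c]] := locally_path_connected_class X_lpc (openI oW oU)
  (conj Wx Ux).
have [N [e [nN e0 NW0]]] := tube oW0 W0x.
near=> y.
have [g gW0] : exists g : hclass (F (y0, t0)) (F (y, t0)), hclass_in W0 g.
  apply/W0c/NW0; first by near: y.
  by rewrite subrr normr0.
have Wy : forall g : hclass (F (y0, t0)) (F (y, t0)), hclass_in W g ->
    K (hmul (hmul (lift y t0) (hinv g)) (hinv (lift y0 t0))) by near: y.
have [|h hH [_ [d dV ->] e']] := Wy g.
  by apply: hclass_in_sub gW0 => x /W0WU[].
(* The element of [K] is [h] times the conjugate of a small loop [d]; the
   short path sought is this loop followed by the joining path. *)
exists (hmul d g).
  apply: hclass_in_mul; first exact: hclass_in_sub dV.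
  by apply: hclass_in_sub gW0 => x /W0WU[].
apply/class_pointP.
suff -> : hmul (lift y t0) (hinv (hmul (lift y0 t0) (hmul d g))) = h by [].
move: (lift y t0) (lift y0 t0) e' => p q e'.
have -> : hmul p (hinv (hmul q (hmul d g))) =
    hmul (hmul (hmul p (hinv g)) (hinv q)) (hmul (hmul q (hinv d)) (hinv q)).
  by rewrite !hinvM !hmulA !hmulKV.
by rewrite -e' -[(h * _)%g]/(hmul _ _) !hmulA !(hmulKV, hmulVK).
Unshelve. all: by end_near. Qed.

Lemma lift_continuous :
  continuous (fun z : Y * I => class_point H (lift z.1 z.2)).
Proof.
move=> [y0 t0] A /= /class_point_nbhs[U [oU Ux UA]].
have [N [e [nN e0 NU]]] := tube oU Ux.
have nJ := unit_interval_ball_nbhs t0 e0.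
exists ([set y | N y /\ exists2 g : hclass (F (y0, t0)) (F (y, t0)),
    hclass_in U g &
    class_point H (lift y t0) = class_point H (hmul (lift y0 t0) g)],
  [set t : I | `|ival t - ival t0| < e]); first split => //=.
  by apply: filterI => //; exact: lift_near.
move=> [y t] [/= [Ny [g gU e']] te].
have -> : class_point H (lift y t) =
    class_point H (hmul (lift y0 t0) (hmul g (track y t0 t))).
  by rewrite -(lift_track y t0 t) hmulA; exact: class_point_mul.
apply: UA; apply: hclass_in_mul => //.
apply: hclass_in_segment te => [u ue|]; first exact: NU.
by rewrite subrr normr0.
Qed.

End lifting.

Theorem theorem3p4 (R : realType) (X : topologicalType) (x0 : X)
    (H : groupClosed (pi1 R x0))
    (X_pc : path_connected R [set: X]%classic)
    (X_lpc : locally_path_connected R X)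
    (H_lqn : locally_quasinormal H)
    (monodromy_cont : forall (x y : X) (beta : {path unit_interval R from x to y}),
      continuous (monodromy H beta : fiber H x -> fiber H y)) :
  hurewicz_fibration R (endpoint_proj H : Xtilde H -> X).
Proof.
move=> Y f F cf cF pf.
pose a y : hclass x0 (F (y, zero)) := hcl (path_cast (pf y) (tagged (repr (f y)))).
have aE y : class_point H (a y) = f y.
  (* The chosen representative of [f y] ends at [F (y, zero)] only up to the
     equality [pf y], which is generalised to be eliminated. *)
  rewrite /a -[RHS]path_point_repr; move: (pf y); rewrite /endpoint_proj.
  case: (repr (f y)) => x p /= e; case: _ / e.
  by rewrite class_point_hcl.
have ca : continuous (fun y => class_point H (a y)).
  by rewrite (_ : (fun y => _) = f)//; apply/funext.
exists (fun z => class_point H (lift cF a z.1 z.2)); split.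
- exact: lift_continuous.
- by move=> [y t]; rewrite endpoint_class_point.
- by move=> y; rewrite /= lift0.
Qed.
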